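(* Let $n\ge 1$ and let $G$ be an abelian dominant subgroup of $Aut(\mathbb{C}^{n})$ with $0\in Fix(G)$. Then there exists a $G$-invariant open set $U$, dense in $\mathbb{C}^{n}$, satisfying: for every $y\in U$ such that $Ker(\Phi_{y})=Ker(\varphi)$, the orbit $G(y)$ is relatively minimal in $U$.
   Context: $Aut(\mathbb{C}^{n})$ is the group (under composition) of holomorphic diffeomorphisms of $\mathbb{C}^{n}$. $0\in Fix(G)$ means $f(0)=0$ for all $f\in G$. For $x\in\mathbb{C}^n$: $G(x)=\{f(x): f\in G\}$; $L_{G}=\{D_{0}f: f\in G\}\subset GL(n,\mathbb{C})$, where $D_0f$ is the differential of $f$ at $0$; $L_{G}(x)=\{Ax: A\in L_{G}\}$; $\widetilde{E}(x)$ is the complex vector space generated by $L_{G}(x)$. $\mathcal{A}(G)$ is the complex vector space generated by $G$ (finite linear combinations of elements of $G$, as maps $\mathbb{C}^n\to\mathbb{C}^n$), and $E(x)=\{f(x): f\in\mathcal{A}(G)\}$. $\Phi_{x}:\mathcal{A}(G)\to\mathbb{C}^{n}$ is the linear map $\Phi_{x}(f)=f(x)$, and $\varphi:\mathcal{A}(G)\to M_{n}(\mathbb{C})$ is the linear map $\varphi(f)=D_{0}f$. $G$ is called dominant if there is $a\in\mathbb{C}^{n}$ such that $\widetilde{E}(a)=E(a)=\mathbb{C}^{n}$ and $Ker(\varphi)=Ker(\Phi_{a})$. A subset $E\subset\mathbb{C}^n$ is $G$-invariant if $f(E)\subset E$ for every $f\in G$. If $\Omega$ is a $G$-invariant set,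 an orbit $O\subset\Omega$ is relatively minimal in $\Omega$ if $\overline{O}\cap\Omega$ is a minimal set in $\Omega$, i.e. it is nonempty, closed in $\Omega$, $G$-invariant and has no proper subset with these properties; equivalently, $\overline{O}\cap\Omega=\overline{G(x)}\cap\Omega$ for every $x\in\overline{O}\cap\Omega$. Closures are taken in $\mathbb{C}^n$. *)

(* Defs.v *)
From mathcomp Require Import all_boot all_order all_algebra.
From mathcomp Require Import complex.
From mathcomp Require Import all_classical all_reals all_analysis.

Set Implicit Arguments.
Unset Strict Implicit.
Unset Printing Implicit Defensive.

Import Order.TTheory GRing.Theory Num.Theory.
Import numFieldNormedType.Exports.

Local Open Scope classical_set_scope.
Local Open Scope complex_scope.
Local Open Scope ring_scope.

(* Bundling [R[i]] as a [numClosedFieldType] is what makes the topology and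
   norm of [numFieldNormedType] available on it. *)
Definition Cplx (R : realType) : numClosedFieldType := R[i].

(* C^n consists of row vectors, so a linear map with matrix A is x |-> x *m A:
   this is the convention of the Jacobian matrix ['J f p]. *)
Notation Cn R n := 'rV[Cplx R]_n.

Section LinearSpan.
Variables (K : fieldType) (V : lmodType K).

Definition lspan (S : set V) : set V :=
  [set v | exists (k : nat) (c : 'I_k -> K) (s : 'I_k -> V),
    (forall i, S (s i)) /\ v = \sum_(i < k) c i *: s i].

End LinearSpan.

Section AutCn.
Variables (R : realType) (n : nat).
Implicit Types (f g : Cn R n -> Cn R n) (G : set (Cn R n -> Cn R n)).
Implicit Types (x y a : Cn R n) (E M O Omega : set (Cn R n)).

(* The scalar field of [Cn R n] is complex, so [differentiable] is complex
   (Frechet) differentiability. *)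
Definition holomorphic f := forall x, differentiable f x.

Definition Aut : set (Cn R n -> Cn R n) :=
  [set f | holomorphic f /\
    exists g, [/\ holomorphic g, cancel f g & cancel g f]].

Definition subgroup_of_Aut G :=
  [/\ G `<=` Aut,
      G idfun,
      forall f g, G f -> G g -> G (f \o g) &
      forall f, G f -> exists g, [/\ G g, cancel f g & cancel g f]].

Definition abelian_maps G := forall f g, G f -> G g -> f \o g = g \o f.

Definition Fix G : set (Cn R n) := [set x | forall f, G f -> f x = x].

Definition orb G x : set (Cn R n) := [set f x | f in G].

Definition LG G : set 'M[Cplx R]_n := [set 'J f 0 | f in G].

Definition LGorb G x : set (Cn R n) := [set x *m A | A in LG G].

Definition Etilde G x : set (Cn R n) := lspan (LGorb G x).

Definition AG G : set (Cn R n -> Cn R n) := lspan G.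

Definition Espace G x : set (Cn R n) := [set f x | f in AG G].

Definition Phi x f : Cn R n := f x.

Definition phi f : 'M[Cplx R]_n := 'J f 0.

Definition KerPhi G x : set (Cn R n -> Cn R n) := AG G `&` [set f | Phi x f = 0].

Definition Kerphi G : set (Cn R n -> Cn R n) := AG G `&` [set f | phi f = 0].

Definition dominant G :=
  exists a, [/\ Etilde G a = setT, Espace G a = setT & Kerphi G = KerPhi G a].

Definition invariant_set G E := forall f, G f -> f @` E `<=` E.

Definition closed_in Omega M := exists2 F, closed F & M = F `&` Omega.

Definition closed_invariant_in G Omega M :=
  [/\ M !=set0, closed_in Omega M & invariant_set G M].

Definition minimal_in G Omega M :=
  closed_invariant_in G Omega M /\
  forall N, closed_invariant_in G Omega N -> N `<=` M -> N = M.

Definition relatively_minimal G Omega O :=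
  O `<=` Omega /\ minimal_in G Omega (closure O `&` Omega).

End AutCn.

(* Main.v *)
(* Let W be the set of x with E(x) = C^n: it is open (a determinant does not
   vanish) and G-invariant, since A(G) is stable under right composition with
   G.  The set U = W u (C^n \ cl W) is then open, dense and invariant, so the
   density of W itself, which would need an identity theorem, is not used.
   If Ker(Phi_y) = Ker(phi) = Ker(Phi_a), then dim E(y) = dim E(a), so y is in
   W.  Minimality amounts to: if z in W is adherent to G(y), then y is adherent
   to G(z).  Ker(phi) is stable under right composition with G, so its elements
   vanish on G(y), hence at z and on G(z).  Let f_1, ..., f_n in A(G) have
   linearly independent values at z, and let F(x) be the matrix with rows
   f_i(x).  Modulo Ker(phi) the f_i form a basis of A(G), in which right
   composition with g is the matrix F(g y) F(y)^-1; this gives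
   g^-1 z = y F(g y)^-1 F(z), which tends to y as g y tends to z. *)

Require Import Defs.
From mathcomp Require Import all_boot all_order all_algebra.
From mathcomp Require Import complex.
From mathcomp Require Import all_classical all_reals all_analysis.
Import numFieldNormedType.Exports.

Local Open Scope classical_set_scope.
Local Open Scope ring_scope.

Import Order.TTheory GRing.Theory Num.Theory.

Set Implicit Arguments.
Unset Strict Implicit.

(** * Limits of matrix products, determinants and inverses *)

Section MatrixLimits.
Variables (K : numFieldType) (T : topologicalType) (z : T).

Lemma cvg_mx_coord (m n : nat) (M : T -> 'M[K]_(m, n)) (L : 'M[K]_(m, n)) :
  (forall i j, M w i j @[w --> z] --> L i j) -> M w @[w --> z] --> L.
Proof.
move=> ML A [P LP PA].
suff : \forall w \near z, forall i j, P i j (M w i j).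
  by apply: filterS => w Pw; exact: PA.
apply: filter_forall => i; apply: filter_forall => j.
exact: ML (LP i j).
Qed.

Lemma cvg_coord (m n : nat) (M : T -> 'M[K]_(m, n)) (L : 'M[K]_(m, n)) i j :
  M w @[w --> z] --> L -> M w i j @[w --> z] --> L i j.
Proof.
move=> ML; exact: (@continuous_cvg _ _ _ (nbhs z) _ M
  (fun A : 'M[K]_(m, n) => A i j) L (@coord_continuous K m n i j L) ML).
Qed.

Lemma cvg_mulmx (m n p : nat) (M : T -> 'M[K]_(m, n)) (N : T -> 'M[K]_(n, p))
    (L : 'M[K]_(m, n)) (L' : 'M[K]_(n, p)) :
  M w @[w --> z] --> L -> N w @[w --> z] --> L' ->
  M w *m N w @[w --> z] --> L *m L'.
Proof.
move=> ML NL; apply: cvg_mx_coord => i j; rewrite mxE.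
under eq_fun do rewrite mxE.
apply: cvg_big => [|k _]; first exact: add_continuous.
by apply: cvgM; apply: cvg_coord.
Qed.

Lemma cvg_det (n : nat) (M : T -> 'M[K]_n) (L : 'M[K]_n) :
  M w @[w --> z] --> L -> \det (M w) @[w --> z] --> \det L.
Proof.
move=> ML; rewrite /determinant.
apply: cvg_big => [|s _]; first exact: add_continuous.
apply: cvgM; first exact: cvg_cst.
apply: cvg_big => [|i _]; first exact: mul_continuous.
exact: cvg_coord.
Qed.

Lemma cvg_adjugate (n : nat) (M : T -> 'M[K]_n) (L : 'M[K]_n) :
  M w @[w --> z] --> L -> \adj (M w) @[w --> z] --> \adj L.
Proof.
move=> ML; apply: cvg_mx_coord => i j; rewrite mxE.
under eq_fun do rewrite mxE.
apply: cvgM; first exact: cvg_cst.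
apply: cvg_det; apply: cvg_mx_coord => k l; rewrite !mxE.
under eq_fun do rewrite !mxE.
exact: cvg_coord.
Qed.

Lemma near_unitmx (n : nat) (M : T -> 'M[K]_n) (L : 'M[K]_n) :
  M w @[w --> z] --> L -> L \in unitmx -> \forall w \near z, M w \in unitmx.
Proof.
move=> ML; rewrite unitmxE unitfE => L0.
apply: filterS (cvgr_neq0 _ (cvg_det ML) L0) => w.
by rewrite unitmxE unitfE.
Qed.

Lemma cvg_invmx (n : nat) (M : T -> 'M[K]_n) (L : 'M[K]_n) :
  M w @[w --> z] --> L -> L \in unitmx -> invmx (M w) @[w --> z] --> invmx L.
Proof.
move=> ML uL; have -> : invmx L = (\det L)^-1 *: \adj L by rewrite /invmx uL.
have adjML : (\det (M w))^-1 *: \adj (M w) @[w --> z] -->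
    (\det L)^-1 *: \adj L.
  apply: cvgZ; last exact: cvg_adjugate.
  by apply: cvgV; [rewrite -unitfE -unitmxE|exact: cvg_det].
(* [invmx] returns a singular matrix unchanged, so the adjugate formula is used only near [z], where
   [M w] is invertible. *)
apply: cvg_trans adjML; apply: near_eq_cvg.
by apply: filterS (near_unitmx ML uL) => w uM; rewrite /invmx uM.
Qed.

Lemma cvg_mulmx_invmx (m n p : nat) (M : T -> 'M[K]_n) (L : 'M[K]_n)
    (A : 'M[K]_(m, n)) (B : 'M[K]_(n, p)) :
  M w @[w --> z] --> L -> L \in unitmx ->
  A *m invmx (M w) *m B @[w --> z] --> A *m invmx L *m B.
Proof.
move=> ML uL; apply: cvg_mulmx; last exact: cvg_cst.
by apply: cvg_mulmx; [exact: cvg_cst|exact: cvg_invmx].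
Qed.

End MatrixLimits.

Lemma dense_setU_closureC (T : topologicalType) (W : set T) :
  dense (W `|` ~` closure W).
Proof.
move=> O [x Ox] Oo; have [Wx|nWx] := pselect (closure W x).
  have [w [Ww Ow]] := Wx O (open_nbhs_nbhs (conj Oo Ox)).
  by exists w; split => //; left.
by exists x; split => //; right.
Qed.

(** * Closure properties of linear spans *)

Section LinearSpan.
Variables (K : fieldType) (V : lmodType K) (S : set V).

Lemma lspan_sub : S `<=` lspan S.
Proof.
move=> s Ss; exists 1%N, (fun=> 1), (fun=> s); split => //.
by rewrite big_ord1 scale1r.
Qed.

Lemma lspanZ c v : lspan S v -> lspan S (c *: v).
Proof.
move=> [k [d [s [Ss ->]]]]; exists k, (fun i => c * d i), s; split => //.
by rewrite scaler_sumr; apply: eq_bigr => i _; rewrite scalerA.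
Qed.

Lemma lspan0 : lspan S 0.
Proof.
by exists 0%N, (fun=> 0), (fun=> 0); split; [case | rewrite big_ord0].
Qed.

Lemma lspanD u v : lspan S u -> lspan S v -> lspan S (u + v).
Proof.
move=> [k [c [s [Ss ->]]]] [l [d [t [St ->]]]].
exists (k + l)%N,
  (fun i : 'I_(k + l) =>
    match fintype.split i with inl j => c j | inr j => d j end),
  (fun i : 'I_(k + l) =>
    match fintype.split i with inl j => s j | inr j => t j end).
split.
  by move=> i; case: fintype.split.
rewrite big_split_ord/=; congr (_ + _); apply: eq_bigr => i _.
  by rewrite (unsplitK (inl _ i)).
by rewrite (unsplitK (inr _ i)).
Qed.

Lemma lspan_sum (I : Type) (r : seq I) (P : pred I) (v : I -> V) :
  (forall i, P i -> lspan S (v i)) -> lspan S (\sum_(i <- r | P i) v i).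
Proof. by move=> Sv; apply: big_ind => //; [exact: lspan0 | exact: lspanD]. Qed.

End LinearSpan.

(** * Evaluation matrices and the points where A(G) spans *)

Section Orbits.
Variables (R : realType) (n : nat) (G : set (Cn R n -> Cn R n)).
Hypotheses (HG : subgroup_of_Aut G) (G0 : Fix G 0).
Implicit Types (g h k : Cn R n -> Cn R n) (f : 'I_n -> Cn R n -> Cn R n).
Implicit Types (x y z : Cn R n) (E U : set (Cn R n)).

Lemma differentiable_group g x : G g -> differentiable g x.
Proof. by case: HG => GA _ _ _ /GA[]. Qed.

Lemma AG_comp h g : AG G h -> G g -> AG G (h \o g).
Proof.
case: HG => _ _ Gcomp _ [k [c [s [Gs ->]]]] Gg.
exists k, c, (fun i => s i \o g); split; first by move=> i; exact: Gcomp.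
by apply/funext => x /=; rewrite !fct_sumE.
Qed.

Lemma AG_differentiable h x : AG G h -> differentiable h x.
Proof.
move=> [k [c [s [Gs ->]]]]; apply: differentiable_sum => i.
exact/differentiableZ/differentiable_group.
Qed.

(** Chain rule at 0: since [g] fixes 0, the differential of [k \o g] there factors through that of
    [k], which is zero. *)
Lemma Kerphi_comp k g : Kerphi G k -> G g -> Kerphi G (k \o g).
Proof.
move=> [Ak k0] Gg; split; first exact: AG_comp.
have dk0 u : 'd k 0 u = 0 by rewrite -mul_rV_lin1 [lin1_mx _]k0 mulmx0.
rewrite /= /phi /jacobian diff_comp; last 2 first.
- exact: differentiable_group.
- exact: AG_differentiable.
apply/matrixP => i j; rewrite mxE /= (G0 Gg).
by rewrite dk0 !mxE.
Qed.

Lemma Espace_invariant g x : G g -> Espace G x = setT -> Espace G (g x) = setT.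
Proof.
case: HG => _ _ _ Ginv Gg ExT; have [h [Gh gK hK]] := Ginv _ Gg.
rewrite -subTset => v _; have : Espace G x v by rewrite ExT.
move=> [k Ak <-]; exists (k \o h); first exact: AG_comp.
by rewrite /= gK.
Qed.

Definition evmx f x : 'M[Cplx R]_n := \matrix_i f i x.

Lemma mul_evmx f (c : Cn R n) x :
  c *m evmx f x = (\sum_i c 0 i *: f i) x.
Proof.
rewrite fct_sumE mulmx_sum_row; apply: eq_bigr => i _.
by rewrite rowK.
Qed.

Lemma AG_lincomb f (c : Cn R n) :
  (forall i, AG G (f i)) -> AG G (\sum_i c 0 i *: f i).
Proof. by move=> Af; apply: lspan_sum => i _; exact/lspanZ/Af. Qed.

(** Turns spanning at a point into invertibility of a matrix that depends continuously on the point,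
    hence into an open condition. *)
Lemma Espace_unitmxP x : Espace G x = setT <->
  exists2 f, forall i, AG G (f i) & evmx f x \in unitmx.
Proof.
split=> [ExT|[f Af fx]].
  have /choice[f Hf] i : exists h, AG G h /\ h x = delta_mx 0 i.
    have : Espace G x (delta_mx 0 i) by rewrite ExT.
    by case=> h; exists h.
  exists f; first by move=> i; case: (Hf i).
  suff -> : evmx f x = 1%:M by exact: unitmx1.
  by apply/row_matrixP => i; rewrite rowK row1; case: (Hf i).
rewrite -subTset => v _.
exists (\sum_i (v *m invmx (evmx f x)) 0 i *: f i); first exact: AG_lincomb.
by rewrite -mul_evmx mulmxKV.
Qed.

Lemma cvg_evmx f (z : Cn R n) : (forall i, AG G (f i)) ->
  evmx f w @[w --> z] --> evmx f z.
Proof.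
move=> Af; apply: cvg_mx_coord => i j; rewrite mxE.
under eq_fun do rewrite mxE.
apply: cvg_coord; exact/differentiable_continuous/AG_differentiable.
Qed.

Lemma open_Espace : open [set x | Espace G x = setT].
Proof.
suff nbhsE x : Espace G x = setT -> \forall w \near x, Espace G w = setT.
  by rewrite openE => x; exact: nbhsE.
move=> /Espace_unitmxP[f Af fx].
apply: filterS (near_unitmx (cvg_evmx (z := x) Af) fx) => w fw.
by apply/Espace_unitmxP; exists f.
Qed.

(** A linear relation between the rows at [y] is an element of A(G) vanishing at [y], hence at [x],
    where independence of the rows makes it trivial. *)
Lemma evmx_unit_transfer f x y : (forall i, AG G (f i)) ->
  (forall h, AG G h -> h y = 0 -> h x = 0) ->
  evmx f x \in unitmx -> evmx f y \in unitmx.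
Proof.
move=> Af yx fx; rewrite -row_free_unit; apply: inj_row_free => c.
rewrite mul_evmx => /yx; rewrite -mul_evmx => /(_ (AG_lincomb _ Af)) cx.
by rewrite -(mulmxK fx c) cx mul0mx.
Qed.

Lemma KerPhi_Espace x y : KerPhi G y = KerPhi G x ->
  Espace G x = setT -> Espace G y = setT.
Proof.
move=> Kyx /Espace_unitmxP[f Af fx]; apply/Espace_unitmxP; exists f => //.
apply: evmx_unit_transfer fx => // h Ah hy.
by have : KerPhi G y h by []; rewrite Kyx => -[].
Qed.

(** * Symmetry of adherence between orbits *)

Section Recurrence.
Variable y : Cn R n.
Hypothesis Ky : KerPhi G y = Kerphi G.

(** Each [k \o g] is again in the kernel, so [k] vanishes on the orbit of [y]; its zero set is
    closed. *)
Lemma Kerphi_closure_orb k z : closure (orb G y) z -> Kerphi G k -> k z = 0.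
Proof.
move=> Gyz Kk; have [Ak _] := Kk.
have ck : continuous k.
  by move=> x; exact/differentiable_continuous/AG_differentiable.
have k0 : closed [set x | k x = 0].
  apply: (@preimage_closed _ _ k [set 0]) => [x _|]; first exact: ck.
  exact/accessible_closed_set1/hausdorff_accessible/norm_hausdorff.
apply: k0; apply: closureS Gyz => _ [g Gg <-] /=.
by have := Kerphi_comp Kk Gg; rewrite -Ky => -[].
Qed.

(** The combination of the [f i] that agrees with [h] at [y] differs from [h] by an element of
    Ker(Phi_y) = Ker(phi), which vanishes at [x]. *)
Lemma AG_coordinates f h x : (forall i, AG G (f i)) -> evmx f y \in unitmx ->
  (forall k, Kerphi G k -> k x = 0) -> AG G h ->
  h x = h y *m invmx (evmx f y) *m evmx f x.
Proof.
move=> Af fy Kx Ah; set c := h y *m _; rewrite mul_evmx.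
apply/eqP; rewrite -subr_eq0; apply/eqP.
apply: (Kx (h - \sum_i c 0 i *: f i)); rewrite -Ky; split.
  by apply: lspanD => //; rewrite -scaleN1r; apply/lspanZ/AG_lincomb.
by rewrite /Phi/= -[(h - _) y]/(h y - _ y) -mul_evmx mulmxKV ?subrr.
Qed.

Lemma closure_orb_sym z : Espace G z = setT -> closure (orb G y) z ->
  closure (orb G z) y.
Proof.
move=> /Espace_unitmxP[f Af fz] Gyz.
have Kz k g : G g -> Kerphi G k -> k (g z) = 0.
  by move=> Gg Kk; exact: (Kerphi_closure_orb Gyz (Kerphi_comp Kk Gg)).
have [_ Gid _ Ginv] := HG.
have fy : evmx f y \in unitmx.
  apply: evmx_unit_transfer fz => // k Ak ky.
  by apply: (Kz k idfun) => //; rewrite -Ky.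
(* For [g] in [G], [back] sends [g y] to the image of [z] under the inverse
   of [g]; it is continuous at [z] with value [y]. *)
pose back w := y *m invmx (evmx f w) *m evmx f z.
have back_inv g h : G g -> G h -> cancel h g -> h z = back (g y).
  move=> Gg Gh hK.
  (* Row [i] is the value of [f i \o g] at [h z], expanded in coordinates read off at [y], where
     this map takes the value [f i (g y)]. *)
  have Ez : evmx f z = evmx f (g y) *m (invmx (evmx f y) *m evmx f (h z)).
    apply/row_matrixP => i; rewrite mulmxA !row_mul !rowK -[in LHS](hK z).
    by apply: (AG_coordinates (h := f i \o g)) => // [k|];
      [exact: Kz|exact: AG_comp].
  have fgy : evmx f (g y) \in unitmx.
    by move: fz; rewrite Ez unitmx_mul => /andP[].
  (* After cancelling [evmx f (g y)], what remains is the coordinate formula for the identity map,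
     an element of G. *)
  rewrite /back Ez -mulmxA (mulKmx fgy) mulmxA.
  by apply: (AG_coordinates (h := idfun)) => // [k|];
    [exact: Kz|exact: lspan_sub].
have back_cvg : back w @[w --> z] --> y.
  have <- : back z = y by rewrite /back mulmxKV.
  by apply: cvg_mulmx_invmx => //; exact: cvg_evmx.
(* The preimage under [back] of a neighbourhood of [y] is a neighbourhood of [z], so it contains
   some [g y]. *)
move=> B /back_cvg /Gyz[_ [[g Gg <-] Bgy]].
have [h [Gh _ hK]] := Ginv _ Gg.
by exists (h z); split; [exists h|rewrite (back_inv _ _ Gg Gh hK)].
Qed.

End Recurrence.

(** * Invariant sets and relative minimality *)

Lemma orb_invariant x : invariant_set G (orb G x).
Proof.
case: HG => _ _ Gcomp _ f Gf _ [_ [g Gg <-] <-].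
by exists (f \o g) => //; exact: Gcomp.
Qed.

Lemma closure_invariant E : invariant_set G E -> invariant_set G (closure E).
Proof.
move=> GE f Gf _ [x Ex <-] B.
move=> /(differentiable_continuous (differentiable_group x Gf)) /Ex[e [Ee Be]].
by exists (f e); split => //; apply: (GE f Gf); exists e.
Qed.

Lemma setI_invariant E1 E2 :
  invariant_set G E1 -> invariant_set G E2 -> invariant_set G (E1 `&` E2).
Proof.
move=> GE1 GE2 f Gf _ [x [E1x E2x] <-].
by split; [apply: (GE1 f Gf)|apply: (GE2 f Gf)]; exists x.
Qed.

Lemma setU_invariant E1 E2 :
  invariant_set G E1 -> invariant_set G E2 -> invariant_set G (E1 `|` E2).
Proof.
move=> GE1 GE2 f Gf _ [x [Ex|Ex] <-].
  by left; apply: (GE1 f Gf); exists x.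
by right; apply: (GE2 f Gf); exists x.
Qed.

Lemma setC_invariant E : invariant_set G E -> invariant_set G (~` E).
Proof.
case: HG => _ _ _ Ginv GE f Gf _ [x nEx <-] Efx; apply: nEx.
have [g [Gg fK _]] := Ginv _ Gf.
by apply: (GE g Gg); exists (f x) => //; exact: fK.
Qed.

Lemma orb_sub E x : invariant_set G E -> E x -> orb G x `<=` E.
Proof. by move=> GE Ex _ [g Gg <-]; apply: (GE g Gg); exists x. Qed.

Lemma orb_refl x : orb G x x.
Proof. by case: HG => _ Gid _ _; exists idfun. Qed.

(** A closed invariant [N] inside the orbit closure contains some [z], hence its orbit; by symmetry
    it contains [y], and then everything adherent to the orbit of [y] in [U]. *)
Lemma relatively_minimal_orb U y : invariant_set G U -> U y ->
  (forall z, U z -> closure (orb G y) z -> closure (orb G z) y) ->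
  relatively_minimal G U (orb G y).
Proof.
move=> GU Uy sym; split; first exact: orb_sub.
split.
  split.
  - by exists y; split => //; apply: subset_closure; exact: orb_refl.
  - by exists (closure (orb G y)) => //; exact: closed_closure.
  - apply: setI_invariant => //; apply: closure_invariant.
    exact: orb_invariant.
move=> N [[z Nz] [C Ccl NE] GN] NM; apply/seteqP; split => // x [Gyx Ux].
have [Gyz Uz] := NM _ Nz.
have Cy : C y.
  apply: Ccl; apply: closureS (sym z Uz Gyz).
  by apply: (subset_trans (orb_sub GN Nz)); rewrite NE => ? [].
rewrite NE; split => //; apply: Ccl; apply: closureS Gyx.
have Ny : N y by rewrite NE.
by apply: (subset_trans (orb_sub GN Ny)); rewrite NE => ? [].
Qed.

End Orbits.

Theorem theorem1p2 (R : realType) (n : nat) (hn : (1 <= n)%N)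
  (G : set (Cn R n -> Cn R n))
  (HG : subgroup_of_Aut G)
  (Gab : abelian_maps G)
  (Gdom : dominant G)
  (G0 : Fix G 0) :
  exists U : set (Cn R n),
    [/\ invariant_set G U, open U, dense U &
      forall y : Cn R n, U y -> KerPhi G y = Kerphi G ->
        relatively_minimal G U (orb G y)].
Proof.
have [a [_ Ea Ka]] := Gdom.
pose W := [set x : Cn R n | Espace G x = setT].
have GW : invariant_set G W by move=> g Gg _ [x Wx <-]; exact: Espace_invariant.
have GU : invariant_set G (W `|` ~` closure W).
  by apply: setU_invariant => //; exact/setC_invariant/closure_invariant.
exists (W `|` ~` closure W); split; first exact: GU.
- apply: openU; first exact: open_Espace.
  exact/closed_openC/closed_closure.
- exact: dense_setU_closureC.
- move=> y Uy Ky; apply: (relatively_minimal_orb HG GU Uy) => z Uz Gyz.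
  have Wy : W y by apply: KerPhi_Espace Ea; rewrite Ky Ka.
  (* The orbit of [y] stays in [W], so its adherent point [z] cannot lie outside the closure of
     [W]. *)
  apply: (closure_orb_sym HG G0 Ky _ Gyz); case: Uz => [//|nWz].
  by case: nWz; apply: closureS Gyz; exact: orb_sub.
Qed.
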